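(* For any (nonzero) ring $R$, neither the Laurent polynomial ring $R[x,x^{-1}]$ nor the polynomial ring $R[x]$ is a $U\sqrt{\Delta}$-ring.
   Context: All rings are associative with identity $1\ne 0$; the variable $x$ commutes with the elements of $R$. For a ring $R$, $U(R)$ is its group of units, $\Delta(R)=\{x\in R \mid x+u\in U(R)\text{ for all }u\in U(R)\}$, and $\sqrt{\Delta(R)}=\{x\in R\mid x^n\in\Delta(R)\text{ for some integer }n\ge 1\}$. A ring $R$ is a $U\sqrt{\Delta}$-ring if every non-unit $a\in R$ can be written as $a=ub$ with $u\in U(R)$ and $b\in\sqrt{\Delta(R)}$. *)

(* Defs.v *)
From HB Require Import structures.
From mathcomp Require Import all_boot all_order all_algebra finmap.
From mathcomp Require Import monalg.

Set Implicit Arguments.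
Unset Strict Implicit.
Unset Printing Implicit Defensive.

Import GRing.Theory.
Local Open Scope fset_scope.
Local Open Scope ring_scope.

(* Laurent polynomials with coefficients in a possibly noncommutative ring R:
   finitely supported functions int -> R, where <<c *g k>> is the monomial
   c x^k and f@_k is the coefficient of x^k in f.  The type int is not a
   monomType (its neutral element is a sum of nonzero elements), so the
   additive group is that of {malg R[int]} and the product is defined here. *)
Definition laurent (R : nzRingType) : Type := {malg R[int]}.

HB.instance Definition _ (R : nzRingType) := GRing.Zmodule.on (laurent R).

Section LaurentRing.

Variable R : nzRingType.
Implicit Types f g h : laurent R.

Definition laurent_one : laurent R := << 1 *g (0 : int) >>.

Definition laurent_mul f g : laurent R :=
  \sum_(i <- msupp f) \sum_(j <- msupp g) << f@_i * g@_j *g i + j >>.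

Lemma laurent_mulw (d1 d2 : {fset int}) f g :
  msupp f `<=` d1 -> msupp g `<=` d2 ->
  laurent_mul f g = \sum_(i <- d1) \sum_(j <- d2) << f@_i * g@_j *g i + j >>.
Proof.
move=> le1 le2; rewrite /laurent_mul (big_fset_incl _ le1) /=.
  apply/eq_bigr=> i _; apply/big_fset_incl => // k _ /mcoeff_outdom ->.
  by rewrite mulr0 monalgU0.
move=> k _ /mcoeff_outdom fk.
by rewrite big1 // => j _; rewrite fk mul0r monalgU0.
Qed.

Lemma laurent_mul0r : left_zero 0 laurent_mul.
Proof. by move=> g; rewrite /laurent_mul msupp0 big_seq_fset0. Qed.

Lemma laurent_mulr0 : right_zero 0 laurent_mul.
Proof.
by move=> g; rewrite /laurent_mul msupp0 big1 // => i _; rewrite big_seq_fset0.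
Qed.

Lemma laurent_mulUg (c : R) (i : int) g :
  laurent_mul << c *g i >> g = \sum_(j <- msupp g) << c * g@_j *g i + j >>.
Proof.
rewrite (laurent_mulw msuppU_le (fsubset_refl _)) big_seq_fset1.
by apply/eq_bigr => j _; rewrite mcoeffUU.
Qed.

Lemma laurent_mulgU f (c : R) (j : int) :
  laurent_mul f << c *g j >> = \sum_(i <- msupp f) << f@_i * c *g i + j >>.
Proof.
rewrite (laurent_mulw (fsubset_refl _) msuppU_le).
by apply/eq_bigr => i _; rewrite big_seq_fset1 mcoeffUU.
Qed.

Lemma laurent_mulUU (c d : R) (i j : int) :
  laurent_mul << c *g i >> << d *g j >> = << c * d *g i + j >>.
Proof. by rewrite (laurent_mulw msuppU_le msuppU_le) !big_seq_fset1 !mcoeffUU. Qed.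

Lemma laurent_mulEl f g :
  laurent_mul f g = \sum_(i <- msupp f) laurent_mul << f@_i *g i >> g.
Proof. by apply/eq_bigr=> i _; rewrite laurent_mulUg. Qed.

Lemma laurent_mulEr f g :
  laurent_mul f g = \sum_(j <- msupp g) laurent_mul f << g@_j *g j >>.
Proof.
rewrite /laurent_mul exchange_big.
by apply/eq_bigr=> j _; rewrite -/(laurent_mul _ _) laurent_mulgU.
Qed.

Lemma laurent_mul1r : left_id laurent_one laurent_mul.
Proof.
move=> g; rewrite laurent_mulUg [RHS]monalgE.
by apply/eq_bigr=> j _; rewrite mul1r add0r.
Qed.

Lemma laurent_mulr1 : right_id laurent_one laurent_mul.
Proof.
move=> f; rewrite laurent_mulgU [RHS]monalgE.
by apply/eq_bigr=> i _; rewrite mulr1 addr0.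
Qed.

Lemma laurent_mulDl : left_distributive laurent_mul +%R.
Proof.
move=> f1 f2 g.
rewrite [in RHS](laurent_mulw (fsubsetUl _ (msupp f2)) (fsubset_refl _)).
rewrite [in RHS](laurent_mulw (fsubsetUr (msupp f1) _) (fsubset_refl _)).
rewrite (laurent_mulw (msuppD_le _ _) (fsubset_refl _)).
rewrite -big_split /=; apply/eq_bigr=> i _.
rewrite -big_split /=; apply/eq_bigr=> j _.
by rewrite mcoeffD mulrDl monalgUD.
Qed.

Lemma laurent_mulDr : right_distributive laurent_mul +%R.
Proof.
move=> f g1 g2.
rewrite [in RHS](laurent_mulw (fsubset_refl _) (fsubsetUl _ (msupp g2))).
rewrite [in RHS](laurent_mulw (fsubset_refl _) (fsubsetUr (msupp g1) _)).
rewrite (laurent_mulw (fsubset_refl _) (msuppD_le _ _)).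
rewrite -big_split /=; apply/eq_bigr=> i _.
rewrite -big_split /=; apply/eq_bigr=> j _.
by rewrite mcoeffD mulrDr monalgUD.
Qed.

Lemma laurent_mulA : associative laurent_mul.
Proof.
move=> f g h.
rewrite [RHS](big_morph (laurent_mul^~ _)
  (fun _ _ => laurent_mulDl _ _ _) (laurent_mul0r _)).
rewrite laurent_mulEl; apply/eq_bigr=> i _.
rewrite [LHS](big_morph (laurent_mul _)
  (fun _ _ => laurent_mulDr _ _ _) (laurent_mulr0 _)).
rewrite [RHS](big_morph (laurent_mul^~ _)
  (fun _ _ => laurent_mulDl _ _ _) (laurent_mul0r _)).
apply/eq_bigr=> j _.
rewrite [LHS](big_morph (laurent_mul _)
  (fun _ _ => laurent_mulDr _ _ _) (laurent_mulr0 _)).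
rewrite laurent_mulEr; apply/eq_bigr=> k _.
by rewrite !laurent_mulUU mulrA addrA.
Qed.

Lemma laurent_one_neq0 : laurent_one != 0.
Proof.
by apply/eqP/malgP=> /(_ 0) /eqP; rewrite mcoeffUU mcoeff0 oner_eq0.
Qed.

HB.instance Definition _ := GRing.Zmodule_isNzRing.Build (laurent R)
  laurent_mulA laurent_mul1r laurent_mulr1 laurent_mulDl laurent_mulDr
  laurent_one_neq0.

End LaurentRing.

(* U(S), as a Prop: the library's GRing.unit requires a unitRingType, and
   neither {poly R} nor laurent R is one over an arbitrary ring R. *)
Definition is_unit (S : nzRingType) (a : S) : Prop :=
  exists b : S, a * b = 1 /\ b * a = 1.

Definition in_Delta (S : nzRingType) (x : S) : Prop :=
  forall u : S, is_unit u -> is_unit (x + u).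

Definition in_sqrt_Delta (S : nzRingType) (x : S) : Prop :=
  exists n : nat, (1 <= n)%N /\ in_Delta (x ^+ n).

Definition UsqrtDelta_ring (S : nzRingType) : Prop :=
  forall a : S, ~ is_unit a ->
    exists u b : S, [/\ is_unit u, in_sqrt_Delta b & a = u * b].

(* Main.v *)
Require Import Defs.
From mathcomp Require Import all_boot all_order all_algebra.
From mathcomp Require Import finmap monalg zify.

(** The witnesses are central non-units: the variable [x] in [R[x]], and
    [1 + x] in [R[x, x^-1]].  If [c] is central and [c = u b] with [u] a unit
    and [b ^+ n] in Delta, then [b ^+ n] is [c ^+ n] times a unit; Delta is
    stable under left multiplication by units, so [c ^+ n] lies in Delta, and
    [c ^+ n + w] is a unit for every unit [w] ([sqrt_Delta_central]).  One
    choice of [w] contradicts this in each ring.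

    In [R[x]], take [w = 1]: [x ^+ n + 1] is monic of positive degree, so its
    nonzero multiples have positive degree and none of them is 1.

    In [R[x, x^-1]], take [w = x ^+ n.+1]: [(1 + x) ^+ n + x ^+ n.+1] has
    lowest term [1] and highest term [x ^+ n.+1].  A Laurent polynomial whose
    lowest and highest terms have distinct exponents and coefficient 1 has no
    right inverse: the lowest (resp. highest) exponents of two factors add up
    in the product as soon as one of the extreme coefficients is 1, so an
    inverse would have its lowest exponent above its highest one
    ([edges_nonunit]).  The same lemma shows that [1 + x] is not a unit. *)

Set Implicit Arguments.
Unset Strict Implicit.
Unset Printing Implicit Defensive.

Import Order.TTheory GRing.Theory Num.Theory.
Local Open Scope fset_scope.
Local Open Scope ring_scope.

(** * Units and Delta in an arbitrary ring *)

Section Delta.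

Variable S : nzRingType.
Implicit Types u v x c : S.

Lemma is_unit1 : is_unit (1 : S).
Proof. by exists 1; rewrite mulr1. Qed.

Lemma is_unitM u v : is_unit u -> is_unit v -> is_unit (u * v).
Proof.
move=> [u' [uu' u'u]] [v' [vv' v'v]]; exists (v' * u'); split.
  by rewrite mulrA -(mulrA u) vv' mulr1.
by rewrite mulrA -(mulrA v') u'u mulr1.
Qed.

Lemma is_unitX u n : is_unit u -> is_unit (u ^+ n).
Proof.
move=> Uu; elim: n => [|n IHn]; first by rewrite expr0; apply: is_unit1.
by rewrite exprS; apply: is_unitM.
Qed.

(** Factoring out the unit: [v x + w = v (x + v^-1 w)]. *)
Lemma in_Delta_mull v x : is_unit v -> in_Delta x -> in_Delta (v * x).
Proof.
move=> Uv Dx w Uw; case: (Uv) => v' [vv' v'v].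
have -> : v * x + w = v * (x + v' * w) by rewrite mulrDr mulrA vv' mul1r.
apply: is_unitM Uv _; apply: Dx; apply: is_unitM Uw.
by exists v.
Qed.

(** Centrality of [c] gives [c ^+ n = u ^+ n * b ^+ n] when [c = u b]. *)
Lemma sqrt_Delta_central c :
  UsqrtDelta_ring S -> (forall x, GRing.comm c x) -> ~ is_unit c ->
  exists2 n, (0 < n)%N & in_Delta (c ^+ n).
Proof.
move=> US cC /US[u [b [Uu [n [n_gt0 Db]] def_c]]]; exists n => //.
case: Uu => u' [uu' u'u].
have def_b : b = u' * c by rewrite def_c mulrA u'u mul1r.
have cub : GRing.comm u b.
  rewrite /GRing.comm -def_c def_b -mulrA cC mulrA u'u mul1r //.
rewrite def_c exprMn_comm //.
by apply: in_Delta_mull Db; apply: is_unitX; exists u'.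
Qed.

End Delta.

(** * Polynomials *)

Lemma monic_nonunit (R : nzRingType) (p : {poly R}) :
  p \is monic -> (1 < size p)%N -> ~ is_unit p.
Proof.
move=> mon_p p_gt1 [q [_ qp1]].
have q_neq0 : q != 0.
  by apply: contraPneq qp1 => ->; rewrite mul0r => /esym/eqP; rewrite oner_eq0.
have := congr1 (fun r : {poly R} => size r) qp1.
have : (0 < size q)%N by rewrite size_poly_gt0.
rewrite size_Mmonic // size_poly1; lia.
Qed.

Lemma poly_not_UsqrtDelta (R : nzRingType) : ~ UsqrtDelta_ring {poly R}.
Proof.
move=> /sqrt_Delta_central - /(_ 'X (fun p => esym (commr_polyX p))) [].
  by apply: monic_nonunit; rewrite ?monicX ?size_polyX.
move=> n n_gt0 /(_ 1 (is_unit1 _)).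
by apply: monic_nonunit; rewrite -polyC1 ?monicXnaddC ?size_XnaddC.
Qed.

(** * Extreme terms of Laurent polynomials *)

Section Laurent.

Variable R : nzRingType.
Implicit Types (f g : laurent R) (s a b i j k : int).

Lemma mcoeff_laurentM f g k :
  (f * g)@_k = \sum_(i <- msupp f) f@_i * g@_(k - i).
Proof.
rewrite [f * g]laurent_mulEl raddf_sum; apply: eq_bigr => i _ /=.
rewrite laurent_mulUg raddf_sum /=.
rewrite [in RHS](monalgE g) [in RHS]raddf_sum mulr_sumr /=.
apply: eq_bigr => j _; rewrite !mcoeffU mulrnAr.
by congr (_ *+ nat_of_bool _); apply/eqP/eqP; lia.
Qed.

(** The sign of [s] selects the end that is bounded: for [s = 1] the support
    of [f] lies above [a], for [s = -1] it lies below [a].  Lowest and highest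
    terms are thus treated at once. *)
Definition bounded_support s a f := forall i, s * i < s * a -> f@_i = 0.

Lemma bounded_supportM s a b f g :
  bounded_support s a f -> bounded_support s b g ->
  bounded_support s (a + b) (f * g).
Proof.
move=> fa gb k ltk; rewrite mcoeff_laurentM big1 // => i _.
have [/fa->|le_ai] := ltP (s * i) (s * a); first by rewrite mul0r.
by rewrite gb ?mulr0 // mulrBr; move: ltk; rewrite mulrDr; lia.
Qed.

(** Only [i = a] contributes to the coefficient of [x ^ (a + b)]. *)
Lemma mcoeffM_edge s a b f g :
  s != 0 -> bounded_support s a f -> bounded_support s b g ->
  (f * g)@_(a + b) = f@_a * g@_b.
Proof.
move=> s_neq0 fa gb; rewrite mcoeff_laurentM.
have other i : i != a -> f@_i * g@_(a + b - i) = 0.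
  move=> i_neqa; case: (ltgtP (s * i) (s * a)) => [/fa->|lt_ai|eq_ai].
  - by rewrite mul0r.
  - by rewrite gb ?mulr0 // mulrBr mulrDr; lia.
  - by case/eqP: i_neqa; apply: (mulfI s_neq0).
have [a_f | a_nf] := boolP (a \in msupp f).
  rewrite (bigD1_seq a) ?fset_uniq //= big1 ?addr0; last by move=> i /other.
  by congr (_ * g@__); lia.
rewrite (mcoeff_outdom a_nf) mul0r big_seq big1 // => i i_f.
by apply: other; apply: contraNneq a_nf => <-.
Qed.

(** [x ^ a] is the extreme term of [f] at the end selected by [s]. *)
Definition monic_edge s a f := bounded_support s a f /\ f@_a = 1.

Lemma monic_edge1 s : monic_edge s 0 1.
Proof.
split=> [i|]; last by rewrite mcoeffUU.
by rewrite mulr0 mcoeffU; case: eqP => // <-; rewrite mulr0 ltxx.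
Qed.

Lemma monic_edgeM s a b f g : s != 0 ->
  monic_edge s a f -> monic_edge s b g -> monic_edge s (a + b) (f * g).
Proof.
move=> s_neq0 [fa f1] [gb g1]; split; first exact: bounded_supportM.
by rewrite (mcoeffM_edge s_neq0 fa gb) f1 g1 mulr1.
Qed.

Lemma monic_edgeX s a f n : s != 0 ->
  monic_edge s a f -> monic_edge s (a *+ n) (f ^+ n).
Proof.
move=> s_neq0 fa; elim: n => [|n IHn]; first exact: monic_edge1.
by rewrite exprS mulrS; apply: monic_edgeM.
Qed.

(** The extreme exponent [j] of [g] gives the extreme term [x ^ (a + j)] of
    [f * g = 1], so that [a + j = 0]. *)
Lemma rinv_bounded_support s a f g : s != 0 ->
  monic_edge s a f -> f * g = 1 -> bounded_support s (- a) g.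
Proof.
move=> s_neq0 [fa f1] fg1 i lt_ia.
have [i_g|/mcoeff_outdom//] := boolP (i \in msupp g).
have [j _ min_j] := arg_minP (fun k : msupp g => s * val k)
  (isT : xpredT [` i_g]%fset).
have gj : bounded_support s (val j) g.
  move=> k lt_kj; apply: mcoeff_outdom; apply/negP => k_g.
  by have := min_j [` k_g]%fset isT; rewrite leNgt lt_kj.
have := mcoeffM_edge s_neq0 fa gj; rewrite fg1 f1 mul1r mcoeffU.
case: eqP => [aj0 _|_ /esym/eqP]; last by rewrite mcoeff_eq0 fsvalP.
have eq_j : val j = - a by apply/eqP; rewrite -addr_eq0 addrC -aj0.
by apply: gj; rewrite eq_j.
Qed.

(** A right inverse would be supported in the empty interval from [- a] to
    [- b]. *)
Lemma edges_nonunit a b f :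
  a < b -> monic_edge 1 a f -> monic_edge (- 1) b f -> ~ is_unit f.
Proof.
move=> lt_ab fa fb [g [fg1 _]].
have ga := rinv_bounded_support (isT : (1 : int) != 0) fa fg1.
have gb := rinv_bounded_support (isT : (- 1 : int) != 0) fb fg1.
have g0 : g = 0.
  apply/malgP => i; rewrite mcoeff0.
  have [lt_i|le_i] := ltP i (- a); first by apply: ga; rewrite !mul1r.
  by apply: gb; lia.
by move/eqP: fg1; rewrite g0 mulr0 eq_sym oner_eq0.
Qed.

Definition laurentX : laurent R := << 1 *g 1 >>.

Lemma laurentX_comm f : GRing.comm laurentX f.
Proof.
rewrite /GRing.comm [LHS]laurent_mulUg [RHS]laurent_mulgU.
by apply: eq_bigr => i _; rewrite mul1r mulr1 addrC.
Qed.

Lemma is_unit_laurentX : is_unit laurentX.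
Proof.
by exists << 1 *g - 1 >>; split; rewrite [LHS]laurent_mulUU mulr1.
Qed.

Lemma laurentXn n : laurentX ^+ n = << 1 *g n%:Z >>.
Proof.
elim: n => [//|n IHn].
by rewrite exprS IHn [LHS]laurent_mulUU mulr1 -intS.
Qed.

Lemma laurent_not_UsqrtDelta : ~ UsqrtDelta_ring (laurent R).
Proof.
pose c : laurent R := 1 + laurentX.
have coefc i : c@_i = (0 == i)%:R + (1 == i)%:R by rewrite mcoeffD !mcoeffU.
have c_lo : monic_edge 1 0 c.
  split=> [i lt_i|]; last by rewrite coefc addr0.
  by rewrite coefc; do 2![case: eqP; first lia]; rewrite addr0.
have c_hi : monic_edge (- 1) 1 c.
  split=> [i lt_i|]; last by rewrite coefc add0r.
  by rewrite coefc; do 2![case: eqP; first lia]; rewrite addr0.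
move/sqrt_Delta_central => /(_ c) [].
- by move=> f; apply/commr_sym/commrD; [apply: commr1|apply/commr_sym/laurentX_comm].
- exact: edges_nonunit c_lo c_hi.
move=> n n_gt0 /(_ _ (is_unitX n.+1 is_unit_laurentX)); rewrite laurentXn.
have [cn_lo cn_0] := monic_edgeX n (isT : (1 : int) != 0) c_lo.
have [cn_hi _] := monic_edgeX n (isT : (- 1 : int) != 0) c_hi.
rewrite mul0rn in cn_lo cn_0; rewrite -[1 *+ n]/(n%:R) natz in cn_hi.
apply: (@edges_nonunit 0 n.+1%:Z) => //; split=> [i lt_i|].
- by rewrite mcoeffD cn_lo // mcoeffU; case: eqP; [lia | rewrite addr0].
- by rewrite mcoeffD cn_0 mcoeffU addr0.
- rewrite mcoeffD cn_hi ?mcoeffU; last by lia.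
  by case: eqP; [lia | rewrite addr0].
- by rewrite mcoeffD cn_hi ?mcoeffUU ?add0r //; lia.
Qed.

End Laurent.

Theorem mainTheorem2 (R : nzRingType) :
  ~ UsqrtDelta_ring (laurent R) /\ ~ UsqrtDelta_ring {poly R}.
Proof.
split; [exact: laurent_not_UsqrtDelta | exact: poly_not_UsqrtDelta].
Qed.
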